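(* Let $(G,P)$ be a lattice-ordered abelian group and let $T\colon P\to\mathcal{B}(H)$ be a regular (contractive) representation of $P$ on a Hilbert space $H$. Then $T$ is Nica-covariant if and only if its isometric co-extension $V$ on $H\otimes_T P$ is Nica-covariant.
   Context: A lattice-ordered abelian group $(G,P)$ is an abelian group $G$ (identity $0$) with a unital subsemigroup $P$ with $P\cap(-P)=\{0\}$ and $G=P-P$, such that for the partial order $g\le h \iff h-g\in P$ any two elements have a least upper bound $\vee$ and a greatest lower bound $\wedge$. Every $g\in G$ is uniquely $g=-g_-+g_+$ with $g_\pm\in P$, $g_-\wedge g_+=0$. A contractive (isometric) representation of $P$ is a unital semigroup homomorphism $T\colon P\to\mathcal{B}(H)$, $s\mapsto T_s$, with each $T_s$ a contraction (an isometry). Its regular extension is $\widetilde T\colon G\to\mathcal{B}(H)$, $\widetilde T(g)=T_{g_-}^*T_{g_+}$. $T$ is called regular if $\widetilde T$ is completely positive definite, i.e. for all $g_1,\dots,g_n\in G$ the operator matrix $[\widetilde T(-g_i+g_j)]_{i,j}$ is positive semidefinite. A contractive representation $T$ is Nica-covariant if $T_s^*T_t=T_tT_s^*$ for all $s,t\in P$ with $s\wedge t=0$. For regular $T$, the Hilbert space $H\otimes_T P$ is the completion of the quotient, by the null vectors, of the space $c_{00}(P,H)$ of finitely supported functions $h\colon P\to H$ with semi-inner product $\langle h,h'\rangle=\sum_{s,t\in P}\langle \widetilde T(-t+s)h(s),h'(t)\rangle$. $H$ embeds as the functions supported at $0$. The isometric co-extension of $T$ on $H\otimes_T P$ is the isometric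 representation $V$ of $P$ induced by $V_p(x\otimes\delta_s)=x\otimes\delta_{p+s}$ ($x\in H$, $p,s\in P$); it satisfies $V_p^*|_H=T_p^*$ and $P_HV_{g_-}^*V_{g_+}|_H=T_{g_-}^*T_{g_+}$. *)

(* Defs.v *)
(* The complex scalars are [R[i]] for [R : realType]. *)
From HB Require Import structures.
From mathcomp Require Import all_boot all_order all_algebra.
From mathcomp Require Import complex.
From mathcomp Require Import all_classical all_reals all_analysis.

Set Implicit Arguments.
Unset Strict Implicit.
Unset Printing Implicit Defensive.

Import Order.TTheory GRing.Theory Num.Theory.
Import numFieldNormedType.Exports.

Local Open Scope classical_set_scope.
Local Open Scope complex_scope.
Local Open Scope ring_scope.

(* [hdot] is linear in its first argument and conjugate-linear in its second. *)
HB.mixin Record CompleteNormedModule_isHilbert (R : realType) H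
    of CompleteNormedModule R[i] H := {
  hdot : {dot H for (@Num.conj R[i])} ;
  hdot_normE : forall x : H, `|x| ^+ 2 = hdot x x
}.

#[short(type="hilbertType")]
HB.structure Definition Hilbert (R : realType) :=
  {H of CompleteNormedModule_isHilbert R H & CompleteNormedModule R[i] H}.

Notation "<| x , y |>" := (hdot x y)
  (at level 0, x at level 99, y at level 99) : ring_scope.

(* For bounded linear [A] the vector selected below exists (Riesz) and is
   unique, so that [adj A] is the Hilbert-space adjoint of [A]. *)
Definition adj (R : realType) (H : hilbertType R) (A : H -> H) (y : H) : H :=
  xget 0 [set z : H | forall x : H, <| A x, y |> = <| x, z |>].

Section LatticeOrderedGroup.
Context (G : zmodType) (P : set G).

Definition cone_le (g h : G) : Prop := P (h - g).

Definition is_glb (a b m : G) : Prop :=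
  [/\ cone_le m a, cone_le m b &
      forall c, cone_le c a -> cone_le c b -> cone_le c m].

Definition is_lub (a b m : G) : Prop :=
  [/\ cone_le a m, cone_le b m &
      forall c, cone_le a c -> cone_le b c -> cone_le m c].

Record lattice_ordered : Prop := LatticeOrdered {
  lo_zero : P 0 ;
  lo_add : forall s t, P s -> P t -> P (s + t) ;
  lo_pointed : P `&` [set - s | s in P] = [set 0] ;
  lo_generating : forall g, exists s t, [/\ P s, P t & g = s - t] ;
  lo_lub : forall a b, exists m, is_lub a b m ;
  lo_glb : forall a b, exists m, is_glb a b m
}.

(* [d] is the pair (g_-, g_+), which exists and is unique in a lattice-ordered
   group. *)
Definition is_decomposition (g : G) (d : G * G) : Prop :=
  [/\ P d.1, P d.2, is_glb d.1 d.2 0 & g = - d.1 + d.2].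

Definition decomposition (g : G) : G * G :=
  xget (0, 0) [set d | is_decomposition g d].

Definition neg_part (g : G) : G := (decomposition g).1.
Definition pos_part (g : G) : G := (decomposition g).2.

End LatticeOrderedGroup.

(* A representation of P is a map defined on all of G, of which only the values
   on P are ever constrained or used. *)
Section Representations.
Context (R : realType) (G : zmodType) (P : set G) (H : hilbertType R).
Implicit Types T : G -> {linear H -> H}.

Record representation T : Prop := Representation {
  repr_zero : forall x, T 0 x = x ;
  repr_add : forall s t, P s -> P t -> forall x, T (s + t) x = T s (T t x)
}.

Definition contractive_representation T : Prop :=
  representation T /\ forall s, P s -> forall x, `|T s x| <= `|x|.

Definition isometric_representation T : Prop :=
  representation T /\ forall s, P s -> forall x, `|T s x| = `|x|.

Definition regular_extension T (g : G) : H -> H :=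
  adj (T (neg_part P g)) \o T (pos_part P g).

(* In [R[i]], [0 <= z] says that z is real and nonnegative. *)
Definition regular T : Prop :=
  forall (n : nat) (g : 'I_n -> G) (x : 'I_n -> H),
    0 <= \sum_(i < n)
           <| \sum_(j < n) regular_extension T (- g i + g j) (x j), x i |>.

Definition nica_covariant T : Prop :=
  forall s t, P s -> P t -> is_glb P s t 0 ->
  forall x, adj (T s) (T t x) = T t (adj (T s) x).

(* c_00(P, H), as functions on G vanishing outside P. *)
Definition c00 : set (G -> H) :=
  [set h | finite_set [set s | h s != 0] /\ [set s | h s != 0] `<=` P].

(* The elementary tensor x \otimes \delta_s. *)
Definition tensor_delta (x : H) (s : G) : G -> H :=
  fun t => if t == s then x else 0.

Definition tensor_dot T (h k : G -> H) : R[i] :=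
  \sum_(s \in P) \sum_(t \in P) <| regular_extension T (- t + s) (h s), k t |>.

End Representations.

Arguments c00 {R G} P {H} _.

(* [K], together with [iota], is the Hilbert space H \otimes_T P: the completion
   of the quotient of [c00 P H] by the null vectors of [tensor_dot P T].  The
   map [iota] sends h to its class; its kernel on [c00 P H] consists exactly of
   the null vectors because the inner product of [K] is definite.  The pair is
   determined up to a unique unitary isomorphism. *)
Record tensor_completion (R : realType) (G : zmodType) (P : set G)
    (H : hilbertType R) (T : G -> {linear H -> H})
    (K : hilbertType R) (iota : (G -> H) -> K) : Prop := TensorCompletion {
  tc_linear : forall (a : R[i]) (h k : G -> H), c00 P h -> c00 P k ->
    iota (fun s => a *: h s + k s) = a *: iota h + iota k ;
  tc_dot : forall h k : G -> H, c00 P h -> c00 P k ->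
    <| iota h, iota k |> = tensor_dot P T h k ;
  tc_dense : closure (iota @` c00 P) = setT
}.

Definition isometric_coextension (R : realType) (G : zmodType) (P : set G)
    (H K : hilbertType R) (iota : (G -> H) -> K) (V : G -> {linear K -> K}) :=
  isometric_representation P V /\
  forall p s (x : H), P p -> P s ->
    V p (iota (tensor_delta x s)) = iota (tensor_delta x (p + s)).

(* Main.v *)
(* For [s, q] in [P] write [q - s = - a + b] with [a], [b] disjoint.  If [T] is
   Nica-covariant, then [V_s^* (x \otimes \delta_q) = T_a^* x \otimes \delta_b],
   which reduces Nica-covariance of [V] on elementary tensors to the uniqueness
   of the decomposition: [a <= s], so [a] is disjoint from [t] when [s] is, and
   [q + t - s = - a + (t + b)] is again disjoint.  Orthogonality to the
   elementary tensors extends this to the whole space.  Conversely,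
   [V_s^* (x \otimes \delta_0) = T_s^* x \otimes \delta_0] always holds, and
   compressing the relation for [V] to [H] gives the one for [T]. *)
Require Import Defs.
From HB Require Import structures.
From mathcomp Require Import all_boot all_order all_algebra.
From mathcomp Require Import complex.
From mathcomp Require Import ring lra.
From mathcomp Require Import all_classical all_reals all_analysis.

Set Implicit Arguments.
Unset Strict Implicit.
Unset Printing Implicit Defensive.

Import Order.TTheory GRing.Theory Num.Theory.
Import numFieldNormedType.Exports.

Local Open Scope classical_set_scope.
Local Open Scope ring_scope.

(** * Inner product geometry of a Hilbert space *)

Section Hilbert.
Context (R : realType) (H : hilbertType R).
Implicit Types (x y z : H) (A : {linear H -> H}).

Lemma hdotDl x y z : <| x + y, z |> = <| x, z |> + <| y, z |>.
Proof. exact: linearDl. Qed.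
Lemma hdotBl x y z : <| x - y, z |> = <| x, z |> - <| y, z |>.
Proof. exact: linearBl. Qed.
Lemma hdotZl a x y : <| a *: x, y |> = a * <| x, y |>.
Proof. exact: linearZl_LR. Qed.
Lemma hdotDr x y z : <| x, y + z |> = <| x, y |> + <| x, z |>.
Proof. exact: linearDr. Qed.
Lemma hdotBr x y z : <| x, y - z |> = <| x, y |> - <| x, z |>.
Proof. exact: linearBr. Qed.
Lemma hdotZr a x y : <| x, a *: y |> = Num.conj a * <| x, y |>.
Proof. exact: linearZr_LR. Qed.
Lemma hdot0l x : <| 0, x |> = 0.
Proof. exact: linear0l. Qed.
Lemma hdot0r x : <| x, 0 |> = 0.
Proof. exact: linear0r. Qed.
Lemma hdotC x y : <| x, y |> = Num.conj <| y, x |>.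
Proof. by rewrite hermC mul1r. Qed.

Lemma hdot_eq0 x : <| x, x |> = 0 -> x = 0.
Proof. by move/eqP; rewrite dnorm_eq0 => /eqP. Qed.

Lemma hdot_inj x y : (forall z, <| x, z |> = <| y, z |>) -> x = y.
Proof. by move=> e; apply/subr0_eq/hdot_eq0; rewrite hdotBl e subrr. Qed.

Lemma conj_norm x : Num.conj `|x| = `|x|.
Proof. by rewrite conj_Creal // normr_real. Qed.

Lemma cauchy_schwarz x y : `|<| x, y |>| <= `|x| * `|y|.
Proof.
have [->|y0] := eqVneq y 0; first by rewrite hdot0r !normr0 mulr0.
have n0 : 0 < `|y| ^+ 2 by rewrite exprn_gt0 // normr_gt0.
rewrite -ler_sqr ?nnegrE ?mulr_ge0 // exprMn.
rewrite normCK -hdotC.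
(* The vector is [x] minus its orthogonal projection onto the line of [y]. *)
have : 0 <= `|x - (<|x, y|> / `|y| ^+ 2) *: y| ^+ 2 by rewrite exprn_ge0.
rewrite hdot_normE !(hdotBl, hdotBr, hdotZl, hdotZr) -!hdot_normE.
rewrite rmorphM fmorphV rmorphXn /= conj_norm -hdotC.
rewrite (_ : _ - _ = `|x| ^+ 2 - <|x, y|> * <|y, x|> / `|y| ^+ 2); last first.
  by field; rewrite normr_eq0.
by rewrite subr_ge0 ler_pdivrMr.
Qed.

(** * Existence of the adjoint of a contraction, by minimisation *)

Section Adjoint.
Variables (A : {linear H -> H}) (A_contr : forall x, `|A x| <= `|x|) (y : H).

(* The Riesz functional [|v|^2 - 2 Re <A v, y>], whose minimiser is [A^* y]. *)
Let riesz v := <| v, v |> - <| A v, y |> - <| y, A v |>.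

(** Completing the square in [A v - y] makes the functional visibly real and, as [A] is a
    contraction, bounded below. *)
Let rieszE v :
  riesz v = `|v| ^+ 2 - `|A v| ^+ 2 + `|A v - y| ^+ 2 - `|y| ^+ 2.
Proof. by rewrite /riesz !hdot_normE !(hdotBl, hdotBr); ring. Qed.

Let riesz_real v : riesz v \is Num.real.
Proof. by rewrite rieszE !(realB, realD, realX) // normr_real. Qed.

Let riesz_ge v : - `|y| ^+ 2 <= riesz v.
Proof.
rewrite rieszE lerBrDr addNr addr_ge0 ?exprn_ge0 // subr_ge0.
by rewrite ler_sqr ?nnegrE.
Qed.

Let riesz_near_min (e : R) : 0 < e ->
  exists u, forall v, riesz u - (e ^+ 2)%:C%C <= riesz v.
Proof.
move=> e0; pose S := range (fun v => complex.Re (riesz v)).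
have lbS : lbound S (complex.Re (- `|y| ^+ 2)).
  move=> _ [v _ <-]; rewrite -lecR !RRe_real ?riesz_ge //.
have infS : has_inf S.
  split; last by exists (complex.Re (- `|y| ^+ 2)).
  by exists (complex.Re (riesz 0)), 0.
have [_ [u _ <-] uS] := inf_adherent (exprn_gt0 2 e0) infS.
exists u => v; rewrite lerBlDr -(RRe_real (riesz_real u)).
rewrite -(RRe_real (riesz_real v)) -rmorphD /= lecR.
apply/ltW/(lt_le_trans uS); rewrite lerD2r.
by apply: ge_inf; [case: infS|exists v].
Qed.

(* Compares [riesz u] with [riesz (u + t x)] for the optimal scalar [t]. *)
Let adjoint_approx (e : R) : 0 < e ->
  exists u, forall x, `|<| A x, y |> - <| x, u |>| <= e%:C%C * `|x|.
Proof.
move=> e0; have [u umin] := riesz_near_min e0; exists u => x.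
have [->|x0] := eqVneq x 0.
  by rewrite linear0 !hdot0l subrr !normr0 mulr0.
have n0 : 0 < `|x| ^+ 2 by rewrite exprn_gt0 // normr_gt0.
have eC0 : 0 <= e%:C%C :> R[i] by rewrite -[0]/(0%:C%C) lecR ltW.
rewrite -ler_sqr ?nnegrE ?mulr_ge0 // exprMn.
set c := _ - _.
have cC : Num.conj c = <| y, A x |> - <| u, x |>.
  by rewrite /c rmorphB /= -!hdotC.
(* This scalar lowers [riesz u] by exactly [|c|^2 / |x|^2], so near-minimality bounds that quotient
   by [e^2]. *)
have := umin (u + (Num.conj c / `|x| ^+ 2) *: x).
rewrite /riesz (linearD A) (linearZ_LR A) !(hdotDl, hdotDr, hdotZl, hdotZr) /=.
rewrite (rmorphM Num.conj) (fmorphV Num.conj) (rmorphXn Num.conj) /=.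
rewrite conj_norm conjCK.
rewrite -!hdot_normE => le_pu.
rewrite -subr_ge0 in le_pu; move: le_pu; set d := (X in 0 <= X -> _).
have -> : d = (e ^+ 2)%:C%C - c * Num.conj c / `|x| ^+ 2.
  by rewrite /d cC /c; field; rewrite normr_eq0.
by rewrite subr_ge0 ler_pdivrMr // rmorphXn normCK.
Qed.

(** The sets [B e] of approximate adjoint vectors are nonempty and shrink with [e]; they generate a
    Cauchy filter, whose limit is the adjoint vector. *)
Lemma adjoint_exists : exists z, forall x, <| A x, y |> = <| x, z |>.
Proof.
pose B (e : R) := [set u | forall x, `|<|A x, y|> - <|x, u|>| <= e%:C%C * `|x|].
have Bmono e e' : e <= e' -> B e `<=` B e'.
  by move=> ee u Bu x; rewrite (le_trans (Bu x)) // ler_wpM2r // lecR.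
pose F := filter_from [set e : R | 0 < e] B.
have FF : Filter F.
  apply: filter_from_filter; first by exists 1; rewrite /= ltr01.
  move=> i j /= i0 j0; exists (Num.min i j); first by rewrite lt_min i0 j0.
  by move=> u Bu; split; apply: Bmono Bu; rewrite ge_min lexx ?orbT.
have PF : ProperFilter F.
  by apply: filter_from_proper => e /adjoint_approx [u Bu]; exists u.
have /cauchy_cvgP Fcvg : cauchy F.
  apply: cauchy_exP => eps eps0.
  have epsR : eps = (complex.Re eps)%:C%C by rewrite RRe_real // gtr0_real.
  (* For [u], [v] in [B d], testing both on [u - v] gives [|u - v|^2 <= 2 d |u - v|], and
     [2 d < eps]. *)
  pose d := complex.Re eps / 3.
  have eps0' : 0 < complex.Re eps by rewrite -ltcR -epsR.
  have d0 : 0 < d by rewrite divr_gt0.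
  have [u Bu] := adjoint_approx d0; exists u; exists d => //= v Bv.
  rewrite -ball_normE /= epsR.
  have [->|uv] := eqVneq u v; first by rewrite subrr normr0 -epsR.
  have n0 : 0 < `|u - v| by rewrite normr_gt0 subr_eq0.
  rewrite -(ltr_pM2l n0) -expr2 -[X in X < _]ger0_norm ?exprn_ge0 //.
  rewrite hdot_normE hdotBr.
  have /le_lt_trans -> // :=
    ler_distD <|A (u - v), y|> <|u - v, u|> <|u - v, v|>.
  rewrite distrC; apply: (le_lt_trans (lerD (Bu _) (Bv _))).
  rewrite -mulrDl mulrC ltr_pM2l // -rmorphD /= ltcR /d; lra.
exists (lim F) => x; apply/eqP; rewrite -subr_eq0 -normr_eq0.
apply/negPn/negP => w0.
set w := `|_ - _| in w0.
have {}w0 : 0 < w by rewrite lt_def w0 normr_ge0.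
have [xE|x0] := eqVneq x 0.
  by move: w0; rewrite /w xE linear0 !hdot0l subrr normr0 ltxx.
have n0 : 0 < `|x| by rewrite normr_gt0.
(* Two errors of size [eps * |x|] add up to [w / 2], which contradicts [w > 0]. *)
pose eps := w / (4 * `|x|).
have eps0 : 0 < eps by rewrite divr_gt0 ?mulr_gt0.
have epsR : eps = (complex.Re eps)%:C%C by rewrite RRe_real // gtr0_real.
have [e /= e0 Be] : F (ball (lim F) eps) by apply/Fcvg/nbhsx_ballx.
(* The bound [e] places [u] near the limit; the bound [Re eps] controls its own error. *)
have d0 : 0 < Num.min e (complex.Re eps) by rewrite lt_min e0 -ltcR -epsR.
have [u Bu] := adjoint_approx d0.
have := Be u (Bmono _ _ _ u Bu); rewrite ge_min lexx => /(_ isT).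
rewrite -ball_normE /= => zu.
have : w <= eps * `|x| + `|x| * eps.
  apply: (le_trans (ler_distD <|x, u|> _ _)); apply: lerD.
    apply: (le_trans (Bu x)); rewrite ler_wpM2r // epsR lecR ge_min.
    by rewrite /= lexx orbT.
  rewrite -hdotBr; apply: (le_trans (cauchy_schwarz _ _)).
  by rewrite ler_wpM2l // distrC ltW.
rewrite (_ : _ + _ = w / 2); last by rewrite /eps; field; rewrite normr_eq0.
by rewrite lt_geF // ltr_pdivrMr // mulr_natr mulr2n ltrDl w0.
Qed.

End Adjoint.

(** Inner products determine a vector, so exhibiting one adjoint vector computes [adj]. *)
Lemma adj_unique (A : H -> H) y z :
  (forall x, <| A x, y |> = <| x, z |>) -> adj A y = z.
Proof.
move=> Az; apply: hdot_inj => x; rewrite hdotC [RHS]hdotC; congr Num.conj.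
rewrite -Az; have : [set w | forall x, <|A x, y|> = <|x, w|>] (adj A y).
  by apply: xgetPex; exists z.
by move=> ->.
Qed.

Lemma hdot_adj A : (forall x, `|A x| <= `|x|) ->
  forall x y, <| A x, y |> = <| x, adj A y |>.
Proof.
by move=> cA x y; have [z zP] := adjoint_exists cA y; rewrite (adj_unique zP).
Qed.

Lemma hdot_adjl A : (forall x, `|A x| <= `|x|) ->
  forall x y, <| adj A x, y |> = <| x, A y |>.
Proof. by move=> cA x y; rewrite hdotC -hdot_adj // -hdotC. Qed.

Lemma adj0 A : adj A 0 = 0.
Proof. by apply: adj_unique => x; rewrite !hdot0r. Qed.

(** If [x] is nonzero, some [y] in [S] lies at distance less than [|x|] from it, whereas
    orthogonality gives [|x - y|^2 = |x|^2 + |y|^2]. *)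
Lemma dense_orthogonal (S : set H) x : closure S = setT ->
  (forall y, S y -> <| y, x |> = 0) -> x = 0.
Proof.
move=> Sdense Sx; apply/eqP/negPn/negP => x0.
have n0 : 0 < `|x| by rewrite normr_gt0.
have : closure S x by rewrite Sdense.
move=> /(_ _ (nbhsx_ballx x _ n0)) [y [Sy]]; rewrite -ball_normE /= => yx.
move: yx; rewrite -ltr_sqr ?nnegrE // hdot_normE !(hdotBl, hdotBr) (Sx y) //.
rewrite [<|x, y|>]hdotC (Sx y) // rmorph0 -!hdot_normE subr0 sub0r opprK.
by move/lt_geF; rewrite lerDl exprn_ge0.
Qed.

End Hilbert.

(** * Disjoint elements and the decomposition into negative and positive parts *)

Section Cone.
Context (G : zmodType) (P : set G) (HP : lattice_ordered P).
Implicit Types a b c g s t : G.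

Let P0 := lo_zero HP.
Let PD s t : P s -> P t -> P (s + t) := @lo_add _ _ HP s t.

Lemma cone_pointed s : P s -> P (- s) -> s = 0.
Proof.
move=> Ps PNs; suff : (P `&` [set - s | s in P]) s by rewrite (lo_pointed HP).
by split=> //; exists (- s) => //; rewrite opprK.
Qed.

Lemma disjointC a b : is_glb P a b 0 -> is_glb P b a 0.
Proof. by case=> a0 b0 ab; split=> // c cb ca; apply: ab. Qed.

Lemma disjoint0 a : P a -> is_glb P a 0 0.
Proof. by move=> Pa; split; rewrite /cone_le ?subrr ?subr0. Qed.

(** If [d] is below [a] and [b + c], then [d - c] is below [a] and [b], so [d] is below [c] and
    hence below [0]. *)
Lemma disjointD a b c :
  is_glb P a b 0 -> is_glb P a c 0 -> is_glb P a (b + c) 0.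
Proof.
move=> [a0 b0 ab] [_ c0 ac]; split=> //.
  by rewrite /cone_le !subr0 in b0 c0 *; apply: PD.
move=> d da dbc; apply: ac => //.
have := ab (d - c); rewrite /cone_le sub0r opprB; apply.
  by rewrite addrA (addrAC a); rewrite /cone_le subr0 in c0; apply: PD.
by rewrite addrA.
Qed.

Lemma disjoint_le a a' b :
  is_glb P a b 0 -> P a' -> cone_le P a' a -> is_glb P a' b 0.
Proof.
move=> [a0 b0 ab] Pa' a'a; split=> //; first by rewrite /cone_le subr0.
move=> c ca' cb; apply: ab => //.
by rewrite /cone_le -(subrKA a'); apply: PD.
Qed.

Lemma disjoint_cone a b : is_glb P a b 0 -> P a /\ P b.
Proof. by case=> a0 b0 _; rewrite /cone_le !subr0 in a0 b0. Qed.

(** Translation preserves meets: subtracting the meet [m] of [g] and [0] from both leaves the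
    disjoint pair [g - m], [- m]. *)
Lemma disjoint_split g : exists a b, is_glb P a b 0 /\ g = - a + b.
Proof.
have [m [mg m0 mP]] := lo_glb HP g 0; rewrite /cone_le sub0r in m0.
exists (- m), (g - m); split; last by rewrite opprK addrC subrK.
split; rewrite /cone_le ?subr0 // => c cm cgm.
have := mP (c + m); rewrite /cone_le !sub0r !opprD (addrC (- c)) !addrA subrr.
by rewrite sub0r; apply.
Qed.

(* The negative part is the least element of [P] that moves [g] into [P]. *)
Lemma disjoint_least a b c :
  is_glb P a b 0 -> P c -> P (- a + b + c) -> cone_le P a c.
Proof.
move=> [a0 b0 ab] Pc Pabc; have := ab (a - c); rewrite /cone_le sub0r opprB.
apply; first by rewrite addrC subrK.
by rewrite addrA addrAC (addrC b).
Qed.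

(** By leastness each of [a] and [c] lies below the other, so they agree by antisymmetry. *)
Lemma disjoint_unique a b c d :
  is_glb P a b 0 -> is_glb P c d 0 -> - a + b = - c + d -> a = c /\ b = d.
Proof.
move=> ab cd e; have [Pa Pb] := disjoint_cone ab.
have [Pc Pd] := disjoint_cone cd.
have ac : a = c.
  apply/esym/subr0_eq/cone_pointed; rewrite ?opprB.
    by apply: disjoint_least ab Pc _; rewrite e addrAC addNr add0r.
  by apply: disjoint_least cd Pa _; rewrite -e addrAC addNr add0r.
by split=> //; move: e; rewrite ac => /addrI.
Qed.

Lemma decompositionE a b :
  is_glb P a b 0 -> decomposition P (- a + b) = (a, b).
Proof.
move=> ab; have [Pa Pb] := disjoint_cone ab.
have dab : is_decomposition P (- a + b) (a, b) by split.
rewrite /decomposition; have := xgetPex (0, 0) (ex_intro _ _ dab).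
case: xget => c d [/= _ _ cd /(disjoint_unique ab cd)] [-> ->] //.
Qed.

End Cone.

(** * Values of the regular extension and inner products of elementary tensors *)

Section RegularExtension.
Context (R : realType) (G : zmodType) (P : set G) (HP : lattice_ordered P).
Context (H : hilbertType R) (T : G -> {linear H -> H}).
Context (Tcontr : contractive_representation P T).
Implicit Types (a b r s t : G) (x y : H).

Let T0 := repr_zero (proj1 Tcontr).
Let TD := repr_add (proj1 Tcontr).

Lemma regular_extensionE a b x :
  is_glb P a b 0 -> regular_extension P T (- a + b) x = adj (T a) (T b x).
Proof.
by move=> ab; rewrite /regular_extension /neg_part /pos_part decompositionE.
Qed.

Lemma regular_extension_cone t x : P t -> regular_extension P T t x = T t x.
Proof.
move=> Pt; have := regular_extensionE x (disjointC (disjoint0 HP Pt)).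
by rewrite oppr0 add0r => ->; apply: adj_unique => y; rewrite T0.
Qed.

Lemma regular_extension0 g : regular_extension P T g 0 = 0.
Proof. by rewrite /regular_extension /= linear0 adj0. Qed.

(* The negative part of [r - b] lies below [b], hence is disjoint from [a]: its
   adjoint commutes with [T a]. *)
Lemma regular_extension_nica a b r y : nica_covariant P T ->
  is_glb P a b 0 -> P r ->
  regular_extension P T (r + a - b) y = T a (regular_extension P T (r - b) y).
Proof.
move=> nica ab Pr; have [Pa Pb] := disjoint_cone ab.
have [c [d [cd rE]]] := disjoint_split HP (r - b).
have [Pc Pd] := disjoint_cone cd.
have cb : cone_le P c b.
  by apply: disjoint_least cd Pb _; rewrite -rE subrK.
have ca : is_glb P c a 0 by apply: disjoint_le (disjointC ab) Pc cb.
(* Here [r + a - b = - c + (a + d)] is again a disjoint decomposition. *)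
rewrite addrAC rE regular_extensionE // -addrA (addrC d).
by rewrite regular_extensionE ?TD ?nica //; apply: disjointD.
Qed.

Lemma finite_support_delta x s : finite_set [set t | tensor_delta x s t != 0].
Proof.
apply: (sub_finite_set _ (finite_set1 s)) => t /=.
by rewrite /tensor_delta; have [->|_] := eqVneq t s; rewrite ?eqxx.
Qed.

Lemma c00_delta x s : P s -> c00 P (tensor_delta x s).
Proof.
move=> Ps; split; first exact: finite_support_delta.
by move=> t /=; rewrite /tensor_delta; have [->|_] := eqVneq t s; rewrite ?eqxx.
Qed.

Lemma tensor_dot_delta x s y t : P s -> P t ->
  tensor_dot P T (tensor_delta x s) (tensor_delta y t) =
  <| regular_extension P T (- t + s) x, y |>.
Proof.
move=> Ps Pt; rewrite /tensor_dot -(@fsbig_widen _ _ _ _ [set s]).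
- rewrite fsbig_set1 -(@fsbig_widen _ _ _ _ [set t]).
  + by rewrite fsbig_set1 /tensor_delta !eqxx.
  + by move=> _ ->.
  + move=> u [_ /eqP/negPf ut] /=; rewrite /tensor_delta ut.
    by rewrite hdot0r.
- by move=> _ ->.
- move=> u [_ /eqP/negPf us] /=; apply: fsbig1 => v _.
  by rewrite /tensor_delta us regular_extension0 hdot0l.
Qed.

End RegularExtension.

(** * Totality of the elementary tensors and the action of the adjoints of the co-extension *)

Section Coextension.
Context (R : realType) (G : zmodType) (P : set G) (HP : lattice_ordered P).
Context (H : hilbertType R) (T : G -> {linear H -> H}).
Context (Tcontr : contractive_representation P T).
Context (K : hilbertType R) (iota : (G -> H) -> K).
Context (HK : tensor_completion P T iota).
Context (V : G -> {linear K -> K}) (HV : isometric_coextension P iota V).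
Implicit Types (a b q r s t : G) (x y : H).

Let P0 := lo_zero HP.
Let TD := repr_add (proj1 Tcontr).
Let Tle s : P s -> forall x, `|T s x| <= `|x| := proj2 Tcontr s.

Let Vle s : P s -> forall x : K, `|V s x| <= `|x|.
Proof. by move=> Ps x; rewrite (proj2 (proj1 HV)). Qed.

Local Notation delta x s := (iota (tensor_delta x s)).

Lemma hdot_delta x s y t : P s -> P t ->
  <| delta x s, delta y t |> = <| regular_extension P T (- t + s) x, y |>.
Proof.
by move=> Ps Pt; rewrite (tc_dot HK) ?tensor_dot_delta //; apply: c00_delta.
Qed.

(** Elementary tensors span [c00], whose image is dense. The induction runs over a list containing
    the support and splits off one tensor at a time. *)
Lemma delta_total (w : K) :
  (forall x s, P s -> <| delta x s, w |> = 0) -> w = 0.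
Proof.
move=> dw; apply: (dense_orthogonal (tc_dense HK)) => _ [h ch <-].
have [l hl] : exists l : seq G, forall s, h s != 0 -> s \in l.
  have [/finite_seqP [l lE] _] := ch; exists l => s hs.
  by have : [set s | h s != 0] s by []; rewrite lE.
elim: l h ch hl => [|s l IH] h ch hl.
  (* With empty support [h] is zero, written as an elementary tensor to fit [dw]. *)
  suff -> : h = tensor_delta 0 0 by apply: dw.
  apply/funext => s; rewrite /tensor_delta if_same; apply/eqP/negPn/negP.
  by move/hl.
have [hs|hs] := eqVneq (h s) 0.
  apply: IH => // t ht; have := hl t ht; rewrite inE => /predU1P [ts|//].
  by rewrite ts hs eqxx in ht.
have Ps : P s by apply: (proj2 ch).
pose k t := if t == s then 0 else h t.
have k_h t : k t != 0 -> h t != 0.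
  by rewrite /k; have [_|_] := eqVneq t s; rewrite ?eqxx.
have ck : c00 P k.
  split; last by move=> t /k_h; apply: (proj2 ch).
  by apply: sub_finite_set (proj1 ch) => t /k_h.
have -> : h = fun t => 1 *: tensor_delta (h s) s t + k t.
  apply/funext => t; rewrite /tensor_delta /k scale1r.
  by case: eqP => [->|_]; rewrite ?addr0 ?add0r.
rewrite (tc_linear HK) //; last exact: c00_delta.
rewrite scale1r hdotDl dw // add0r; apply: IH => // t kt.
have := hl t (k_h t kt); rewrite inE => /predU1P [ts|//].
by rewrite /k ts eqxx eqxx in kt.
Qed.

(** Tested against the tensor of [y] at [r], the two sides involve the regular extension at
    [r + a - b] and at [r - b]; the last hypothesis equates them. Keeping it abstract serves both
    implications: it follows from Nica-covariance, and for [b = 0] from multiplicativity. *)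
Lemma adj_coextension a b s q x :
  P a -> P b -> P s -> P q -> - s + q = - a + b ->
  (forall r y, P r ->
    regular_extension P T (r + a - b) y =
    T a (regular_extension P T (r - b) y)) ->
  adj (V s) (delta x q) = delta (adj (T a) x) b.
Proof.
move=> Pa Pb Ps Pq e reg; apply/subr0_eq/delta_total => y r Pr.
rewrite hdotBr -hdot_adj; last exact: Vle.
rewrite (proj2 HV) // !hdot_delta //; last exact: lo_add.
rewrite -hdot_adj; last exact: Tle.
rewrite (addrC (- b)) -reg // -addrA (_ : - q + _ = r + (a - b)) ?subrr //.
have : - (- s + q) = - (- a + b) by rewrite e.
by rewrite !opprD !opprK => <-; rewrite [RHS]addrC addrA (addrC s).
Qed.

(** * The two implications *)

Lemma nica_coextension : nica_covariant P T -> nica_covariant P V.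
Proof.
move=> nica s t Ps Pt st.
have adj_delta x q a b : P q -> is_glb P a b 0 ->
    - s + q = - a + b -> adj (V s) (delta x q) = delta (adj (T a) x) b.
  move=> Pq ab e; have [Pa Pb] := disjoint_cone ab.
  apply: adj_coextension => // r y Pr; exact: regular_extension_nica.
have on_delta x q : P q ->
    adj (V s) (V t (delta x q)) = V t (adj (V s) (delta x q)).
  move=> Pq; have [a [b [ab e]]] := disjoint_split HP (- s + q).
  have [Pa Pb] := disjoint_cone ab.
  (* Adding [s] moves [- s + q] to [q] in [P], and [a] is the least element of [P] that moves it
     into [P]. *)
  have le_as : cone_le P a s.
    by apply: disjoint_least ab Ps _; rewrite -e addrAC addNr add0r.
  have at0 : is_glb P a t 0 by apply: disjoint_le st Pa le_as.
  rewrite (adj_delta _ _ _ _ Pq ab e) !(proj2 HV) //.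
  apply: adj_delta => //; [exact: lo_add|exact: disjointD|].
  by rewrite addrCA e addrCA.
(* With all operators moved to the second argument, testing [u] on the
   elementary tensors suffices, and no continuity is involved. *)
move=> u; apply: hdot_inj => w.
rewrite hdot_adjl; last exact: Vle.
rewrite hdot_adj; last exact: Vle.
rewrite hdot_adj; last exact: Vle.
rewrite hdot_adjl; last exact: Vle.
congr <|u, _|>; apply/subr0_eq/delta_total => x q Pq.
rewrite hdotBr -hdot_adj; last exact: Vle.
rewrite -hdot_adjl; last exact: Vle.
rewrite on_delta // hdot_adj; last exact: Vle.
by rewrite hdot_adjl ?subrr //; apply: Vle.
Qed.

Lemma nica_compression : nica_covariant P V -> nica_covariant P T.
Proof.
move=> nica s t Ps Pt st x; apply: hdot_inj => y.
have Vs : adj (V s) (delta x 0) = delta (adj (T s) x) 0.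
  apply: adj_coextension => // r z Pr; rewrite !subr0.
  rewrite !regular_extension_cone //.
    by rewrite addrC TD.
  exact: lo_add.
have := nica s t Ps Pt st (delta x 0); rewrite Vs !(proj2 HV) // addr0.
(* Pairing with [y] at [0] is the compression to [H]: the left side becomes the regular extension at
   [- s + t], which disjointness evaluates, and the right side the one at [t]. *)
move=> /(congr1 (fun w => <| w, delta y 0 |>)).
rewrite hdot_adjl; last exact: Vle.
rewrite (proj2 HV) // !hdot_delta ?addr0 // oppr0 add0r.
by rewrite regular_extensionE // regular_extension_cone.
Qed.

End Coextension.

Theorem theorem2p5p10 (R : realType) (G : zmodType) (P : set G)
    (HP : lattice_ordered P)
    (H : hilbertType R) (T : G -> {linear H -> H})
    (Tcontr : contractive_representation P T) (Treg : regular P T)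
    (K : hilbertType R) (iota : (G -> H) -> K)
    (HK : tensor_completion P T iota)
    (V : G -> {linear K -> K}) (HV : isometric_coextension P iota V) :
  nica_covariant P T <-> nica_covariant P V.
Proof.
by split; [exact: (nica_coextension HP Tcontr HK HV)|
  exact: (nica_compression HP Tcontr HK HV)].
Qed.
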